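(* Let $f_1=1$, $f_2=1$ and $f_{i+2}=f_i+f_{i+1}$ be the Fibonacci numbers, and let $n$ be a positive integer (the finger count). If there exists an integer $i$ such that $f_{2i}\leqslant n<f_{2i+1}$, then the Simple Chopsticks position $[1]\,[1]_n$ (each player has one hand with one raised finger) is an $\mathcal{N}$-position (next player wins); otherwise it is a $\mathcal{P}$-position (previous player wins).
   Context: Simple Chopsticks (the paper's generalization of Chopsticks). Fix a positive integer $n$, the finger count. A position $[x_1,\ldots,x_\ell]\,[y_1,\ldots,y_r]_n$ consists of a finite non-decreasing sequence $(x_1,\ldots,x_\ell)$ of integers in $\{1,\ldots,n\}$ (Left's hands, $x_i$ = number of raised fingers) and a finite non-decreasing sequence $(y_1,\ldots,y_r)$ of integers in $\{1,\ldots,n\}$ (Right's hands); either list may be empty. Left's moves: for any $i\in\{1,\ldots,\ell\}$ and $j\in\{1,\ldots,r\}$, replace $y_j$ by $y_j+x_i$ (re-sorting), and if $y_j+x_i>n$ remove that entry from Right's list instead. Right's moves: for any $i,j$, replace $x_i$ by $x_i+y_j$, removing it if $x_i+y_j>n$. In particular no moves are available when either list is empty. The game is played under normal play: a player who cannot move on their turn loses. Outcome classes: $\mathcal{N}$ = the player moving first wins; $\mathcal{P}$ = the player moving second wins; $\mathcal{L}$ = Left wins whoever moves first; $\mathcal{R}$ = Right wins whoever moves first. *)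

(* Defs.v *)
From HB Require Import structures.
From mathcomp Require Import all_boot.
Set Implicit Arguments.
Unset Strict Implicit.
Unset Printing Implicit Defensive.

(* [fib 0 = 0] only serves to start the recursion: the sequence f is indexed
   from 1, with f_1 = f_2 = 1. *)
Fixpoint fib (k : nat) : nat :=
  match k with
  | 0 => 0
  | k'.+1 => match k' with
             | 0 => 1
             | k''.+1 => fib k'' + fib k'
             end
  end.

Definition is_hands (n : nat) (s : seq nat) : bool :=
  sorted leq s && all (fun x => 0 < x <= n) s.

Record hands (n : nat) := Hands {
  fingers :> seq nat;
  handsP : is_hands n fingers
}.

Record position (n : nat) := Position {
  left_hands : hands n;
  right_hands : hands n
}.

(* Adds [a] to the [j]-th entry of [s]; the entry disappears when the sum
   exceeds [n]. *)
Definition tap_seq (n a : nat) (s : seq nat) (j : nat) : seq nat :=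
  let y := nth 0 s j + a in
  sort leq (take j s ++ (if y <= n then [:: y] else [::]) ++ drop j.+1 s).

Lemma tap_subproof (n : nat) (s t : hands n) (i : 'I_(size s))
  (j : 'I_(size t)) : is_hands n (tap_seq n (nth 0 s i) t j).
Proof.
have /andP[_ As] := handsP s; have /andP[_ At] := handsP t.
rewrite /is_hands /tap_seq sort_sorted; last exact: leq_total.
rewrite all_sort !all_cat.
have := At; rewrite -{1}(cat_take_drop j t) all_cat => /andP[-> Ad] /=.
have -> : all (fun x => 0 < x <= n) (drop j.+1 t).
  by move: Ad; rewrite (drop_nth 0) //= => /andP[].
case: ifP => //= ->; rewrite !andbT addn_gt0.
by have /andP[-> _] := all_nthP 0 At j (ltn_ord j).
Qed.

Definition tap (n : nat) (s t : hands n) (i : 'I_(size s))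
  (j : 'I_(size t)) : hands n := Hands (tap_subproof i j).

Inductive player := Left | Right.

Definition opponent (p : player) : player :=
  match p with Left => Right | Right => Left end.

Inductive move (n : nat) : player -> position n -> position n -> Prop :=
| LeftMove (x y : hands n) (i : 'I_(size x)) (j : 'I_(size y)) :
    move Left (Position x y) (Position x (tap i j))
| RightMove (x y : hands n) (i : 'I_(size x)) (j : 'I_(size y)) :
    move Right (Position x y) (Position (tap j i) y).

(* [wins_first p G]: player [p] can force a win from [G] when [p] starts;
   [wins_second p G]: when the opponent of [p] starts.  The second holds in
   particular when the opponent has no move (normal play). *)
Inductive wins_first (n : nat) : player -> position n -> Prop :=
| WinsFirst (p : player) (G G' : position n) :
    move p G G' -> wins_second p G' -> wins_first p G
with wins_second (n : nat) : player -> position n -> Prop :=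
| WinsSecond (p : player) (G : position n) :
    (forall G' : position n, move (opponent p) G G' -> wins_first p G') ->
    wins_second p G.

Definition N_position (n : nat) (G : position n) : Prop :=
  wins_first Left G /\ wins_first Right G.

Definition P_position (n : nat) (G : position n) : Prop :=
  wins_second Left G /\ wins_second Right G.

Lemma one_hand_subproof (n : nat) : 0 < n -> is_hands n [:: 1].
Proof. by move=> n_gt0; rewrite /is_hands /= n_gt0. Qed.

Definition one_hand (n : nat) (n_gt0 : 0 < n) : hands n :=
  Hands (one_hand_subproof n_gt0).

(* Main.v *)
(** When both players have a single hand, every move is forced: if the player
    to move shows [a] fingers and the opponent [b], the opponent is tapped to
    [a + b], and is left without hands (and so loses) exactly when [a + b > n].
    From [1] [1] the hand of the mover and that of the opponent thus run through
    (f_2, f_1), (f_3, f_2), (f_4, f_3), ..., and the game ends with the move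
    producing the first Fibonacci number above [n]; the parity of its index
    determines who makes that move. *)

Require Import Defs.
From HB Require Import structures.
From mathcomp Require Import all_boot.
Set Implicit Arguments.
Unset Strict Implicit.
Unset Printing Implicit Defensive.

Lemma fibS2 k : fib k.+2 = fib k + fib k.+1.
Proof. by []. Qed.

Lemma fib_leS k : fib k <= fib k.+1.
Proof. by case: k => [|k] //; rewrite fibS2 leq_addl. Qed.

Lemma fib_homo : {homo fib : j k / j <= k}.
Proof. by apply: homo_leq => [//| |k]; [exact: leq_trans | exact: fib_leS]. Qed.

Lemma leq_fibS k : k <= fib k.+1.
Proof.
elim: k => [//|[//|k] IHk]; rewrite fibS2 -add1n leq_add //.
exact: (fib_homo (ltn0Sn k)).
Qed.

(** Take the least index whose Fibonacci number exceeds [n]; it is at least 3, as the terms of index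
    0, 1, 2 are at most 1. *)
Lemma fib_bracket n : 0 < n -> exists d, fib d.+2 <= n < fib d.+3.
Proof.
move=> n_gt0; have ex_gt : exists k, n < fib k by exists n.+2; exact: leq_fibS.
case: (ex_minnP ex_gt) => -[|[|[|d]]] lt_n min_d //;
  try by move: lt_n; rewrite ltnNge n_gt0.
by exists d; rewrite lt_n andbT leqNgt; apply/negP => /min_d; rewrite ltnn.
Qed.

(** The mover's hands come first, so that one argument serves both players. *)
Definition hands_of (n : nat) (p : player) (x y : hands n) : position n :=
  if p is Left then Position x y else Position y x.

Lemma hands_of_opponent n p (x y : hands n) :
  hands_of (opponent p) x y = hands_of p y x.
Proof. by case: p. Qed.

Lemma moveP n p (x y : hands n) G :
  move p (hands_of p x y) G <->
  exists (i : 'I_(size x)) (j : 'I_(size y)), G = hands_of p x (tap i j).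
Proof.
split=> [|[i [j ->]]]; last by case: p; constructor.
by case: p => /= mvG; inversion mvG; subst; [exists i, j | exists j, i].
Qed.

Lemma fingers_tap1 n (x y : hands n) a b (i : 'I_(size x)) (j : 'I_(size y)) :
  fingers x = [:: a] -> fingers y = [:: b] ->
  fingers (tap i j) = if b + a <= n then [:: b + a] else [::].
Proof.
move=> def_x def_y; rewrite /= /tap_seq.
have /eqP-> : val i == 0 by rewrite -leqn0 -ltnS; have := ltn_ord i; rewrite {2}def_x.
have /eqP-> : val j == 0 by rewrite -leqn0 -ltnS; have := ltn_ord j; rewrite {2}def_y.
by rewrite def_x def_y /=; case: ifP.
Qed.

Lemma wins_second_no_hands n p (x y : hands n) :
  fingers y = [::] -> wins_second p (hands_of p x y).
Proof.
move=> def_y; constructor=> G; rewrite -hands_of_opponent => /moveP[i].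
by case: i => i lt_i; exfalso; move: lt_i; rewrite def_y.
Qed.

(* [d] is the number of moves played before the winning one. *)
Lemma fib_hands_winner n d m p (x y : hands n) :
    fib (d + m).+2 <= n < fib (d + m).+3 ->
    fingers x = [:: fib m.+2] -> fingers y = [:: fib m.+1] ->
  if odd d then wins_second (opponent p) (hands_of p x y)
  else wins_first p (hands_of p x y).
Proof.
elim: d m p x y => [|d IHd] m p x y /andP[le_n lt_n] def_x def_y.
  have lt0x : 0 < size x by rewrite def_x.
  have lt0y : 0 < size y by rewrite def_y.
  apply: (@WinsFirst _ _ _ (hands_of p x (tap (Ordinal lt0x) (Ordinal lt0y)))).
    by apply/moveP; exists (Ordinal lt0x), (Ordinal lt0y).
  apply: wins_second_no_hands.
  by rewrite (fingers_tap1 _ _ def_x def_y) -fibS2 leqNgt lt_n.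
have le_m : fib m.+3 <= n.
  by apply: leq_trans le_n; apply: fib_homo; rewrite !ltnS leq_addl.
(* After the tap the roles swap: [opponent p] moves with [fib m.+3] against [fib m.+2], which is the
   induction hypothesis at [m.+1]. *)
have next i j : if odd d then wins_second p (hands_of p x (@tap n x y i j))
                else wins_first (opponent p) (hands_of p x (tap i j)).
  have := IHd m.+1 (opponent p) (tap i j) x.
  rewrite hands_of_opponent addnS -addSn le_n lt_n def_x => IH.
  have def_xy : fingers (tap i j) = [:: fib m.+3].
    by rewrite (fingers_tap1 _ _ def_x def_y) -fibS2 le_m.
  by have := IH isT def_xy erefl; case: (p).
rewrite [odd _]/=; case: (odd d) next => /= next.
  have lt0x : 0 < size x by rewrite def_x.
  have lt0y : 0 < size y by rewrite def_y.
  apply: WinsFirst (next (Ordinal lt0x) (Ordinal lt0y)).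
  by apply/moveP; exists (Ordinal lt0x), (Ordinal lt0y).
constructor=> G mvG.
(* [opponent (opponent p)] reduces to [p] only once [p] is known. *)
have {mvG} : move p (hands_of p x y) G by case: (p) mvG.
by case/moveP=> i [j ->]; exact: next.
Qed.

Theorem theorem2p1 (n : nat) (n_gt0 : 0 < n) :
  ((exists i : nat, 0 < i /\ fib (2 * i) <= n < fib (2 * i + 1)) ->
     N_position (Position (one_hand n_gt0) (one_hand n_gt0))) /\
  (~ (exists i : nat, 0 < i /\ fib (2 * i) <= n < fib (2 * i + 1)) ->
     P_position (Position (one_hand n_gt0) (one_hand n_gt0))).
Proof.
have winner d p : fib d.+2 <= n < fib d.+3 ->
    if odd d
    then wins_second (opponent p) (Position (one_hand n_gt0) (one_hand n_gt0))
    else wins_first p (Position (one_hand n_gt0) (one_hand n_gt0)).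
  (* The start is the case [m = 0], since [fib 2] and [fib 1] are both 1. *)
  rewrite -[d in fib d.+2]addn0 -[d in fib d.+3]addn0 => fib_n.
  have def_1 : fingers (one_hand n_gt0) = [:: 1] by [].
  by have := fib_hands_winner p fib_n def_1 def_1; case: (p).
split=> [[[|i] [// _]] | no_i].
  (* With [i.+1] for the index, [d] is [i.*2], hence even. *)
  rewrite addn1 mul2n doubleS => fib_n.
  have first p := winner _ p fib_n; rewrite odd_double in first.
  by split; apply: first.
have [d fib_n] := fib_bracket n_gt0.
have odd_d : odd d.
  (* For even [d], the index [d./2.+1] doubles to [d.+2]. *)
  apply/negPn/negP => even_d; apply: no_i; exists (d./2.+1); split=> //.
  by rewrite addn1 mul2n doubleS even_halfK.
have second p := winner _ p fib_n; rewrite odd_d in second.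
(* [second p] speaks of [opponent p], hence the exchanged players. *)
by split; [apply: (second Right) | apply: (second Left)].
Qed.
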